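(* Let $\Lambda\colon\mathbb{R}\to[0,1]$ have bounded variation and be right lower semicontinuous (i.e. $\liminf_{y\downarrow x}\Lambda(y)\ge\Lambda(x)$ for all $x\in\mathbb{R}$). Then there exist an increasing function $\Lambda_{\mathrm{inc}}\colon\mathbb{R}\to[0,1]$, a fixed weight $\lambda\in(0,1]$ with $\lambda\ge\Lambda_{\mathrm{inc}}(-\infty)$, and a fixed $G\in\mathcal M$ such that, for all $F\in\mathcal M$, $$Q_\Lambda^-(F)=Q_{\Lambda_{\mathrm{inc}}}^-\big(\lambda F+(1-\lambda)G\big)\quad\text{and}\quad Q_\Lambda^+(F)=Q_{\Lambda_{\mathrm{inc}}}^+\big(\lambda F+(1-\lambda)G\big),$$ and such that, if $\Lambda$ is in standard representation, then so is $\Lambda_{\mathrm{inc}}$.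
   Context: $\mathcal M$ is the set of cumulative distribution functions on $\mathbb{R}$. For $\Lambda\colon\mathbb{R}\to[0,1]$ and $F\in\mathcal M$, $Q_\Lambda^-(F):=\inf\{x\in\mathbb{R}\mid F(x)\ge\Lambda(x)\}$ and $Q_\Lambda^+(F):=\inf\{x\in\mathbb{R}\mid F(x)>\Lambda(x)\}$, with values in $[-\infty,\infty]$ and $\inf\varnothing=\infty$. ''Increasing'' is in the weak sense. $f(-\infty):=\lim_{x\to-\infty}f(x)$. Bounded variation means $\sup\{\sum_{i=1}^n|\Lambda(x_i)-\Lambda(x_{i-1})| : n\in\mathbb{N},\ x_0<\dots<x_n\}<\infty$. A function $\Lambda\colon\mathbb R\to[0,1]$ is in standard representation if $\Lambda(x)=0$ for all real $x>N_0$, where $N_0:=\inf\{x\in\mathbb{R}\mid\Lambda(x)=0\}$. *)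

(* Defs.v *)
From HB Require Import structures.
From mathcomp Require Import all_boot all_order all_algebra.
From mathcomp Require Import all_classical all_reals all_analysis.
Set Implicit Arguments.
Unset Strict Implicit.
Unset Printing Implicit Defensive.
Import Order.TTheory GRing.Theory Num.Theory.
Import numFieldNormedType.Exports.

Local Open Scope classical_set_scope.
Local Open Scope ring_scope.

Section Lambda_quantiles.
Context {R : realType}.
Implicit Types (L F f : R -> R).

(* Nondecreasing right-continuous functions with limits 0 at -oo and 1 at +oo *)
Definition cdfun := cumulativeBounded (0 : R) (1 : R).

Definition unit_valued L := forall x, 0 <= L x <= 1.

(* The quantiles take a bare function F, so that they apply to a mixture of
   CDFs without rebuilding its [cdfun] structure. The infimum is taken in
   \bar R, where the empty set has infimum +oo. *)
Definition quantile_lower L F : \bar R :=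
  ereal_inf [set x%:E | x in [set x | L x <= F x]].

Definition quantile_upper L F : \bar R :=
  ereal_inf [set x%:E | x in [set x | L x < F x]].

(* [variations a b f] collects the sums over the partitions
   a = x_0 < ... < x_n = b; here a and b range over the whole line. *)
Definition bounded_variation_line f :=
  has_ubound [set v | exists a b : R, variations a b f v].

(* [x^'+] is the filter of right neighborhoods of x with x itself removed *)
Definition right_lower_semicontinuous f :=
  forall x : R, ((f x)%:E <= limf_einf (EFin \o f) x^'+)%E.

Definition first_zero L : \bar R := ereal_inf [set x%:E | x in [set x | L x = 0]].

Definition standard_representation L :=
  forall x : R, (first_zero L < x%:E)%E -> L x = 0.

Definition limit_at_Ny f : R := lim (f x @[x --> -oo]).

End Lambda_quantiles.

Arguments cdfun : clear implicits.

(* Main.v *)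
(* Write L + N = (increasing) with N the negative variation of L, taken here as
   the pointwise least nonnegative increasing function such that L + N is
   increasing. Minimality gives N(-oo) = 0, and right lower semicontinuity of L
   makes N right-continuous, so N = n G for a CDF G, with n the supremum of N.
   Since F >= L iff F + n G >= L + N, scaling by lambda = 1 / (1 + n) makes the
   left-hand side a mixture and lambda (L + N) an increasing function with
   values in [0, 1]. *)
From HB Require Import structures.
Require Import Defs.
From mathcomp Require Import all_boot all_order all_algebra.
From mathcomp Require Import all_classical all_reals all_analysis.
From mathcomp Require Import lra.
Set Implicit Arguments.
Unset Strict Implicit.
Unset Printing Implicit Defensive.
Import Order.TTheory GRing.Theory Num.Theory.
Import numFieldNormedType.Exports.
Local Open Scope classical_set_scope.
Local Open Scope ring_scope.

Definition compensator (R : realType) (L g : R -> R) :=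
  [/\ forall x, 0 <= g x, nondecreasing_fun g & nondecreasing_fun (L \+ g)].

Definition negative_variation (R : realType) (L : R -> R) (x : R) : R :=
  inf [set g x | g in compensator L].

Definition variation_upto (R : realType) (L : R -> R) (x : R) : set R :=
  [set v | exists a, variations a x L v].

Lemma variation_upto0 (R : realType) (L : R -> R) (x : R) :
  variation_upto L x 0.
Proof. by exists x, [::]; [split=> //=|rewrite variation_nil]. Qed.

(** The witness is the total variation of [L] on []-oo, x]]. It shows that compensators exist and,
    since the negative variation lies below it, that the latter is bounded. *)
Lemma compensator_variation (R : realType) (L : R -> R) (M : R) :
  (forall x, ubound (variation_upto L x) M) ->
  exists2 V, compensator L V & forall x, V x <= M.
Proof.
move=> LM; pose V x := sup (variation_upto L x).
have ubV x : has_ubound (variation_upto L x) by exists M; exact: LM.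
have V_ge x v : variation_upto L x v -> v <= V x by exact: ub_le_sup.
(* Appending [y] to a partition that ends at [x] adds [|L y - L x|] to its sum. Both monotonicity
   conditions follow from this inequality. *)
have Vstep x y : x < y -> V x + `|L y - L x| <= V y.
  move=> xy; rewrite -lerBrDr; apply: ge_sup.
    by exists 0; exact: variation_upto0.
  move=> v [a [s axs <-]]; rewrite lerBrDr.
  have xy1 := itv_partition1 xy.
  have <- : variation x y L [:: y] = `|L y - L x|.
    by rewrite /variation /= big_nat1.
  rewrite -(variation_cat _ (itv_partition_le axs) (ltW xy) axs xy1).
  by apply: V_ge; exists a, (s ++ [:: y]) => //; exact: itv_partition_cat axs xy1.
have nd (f : R -> R) : (forall x y, x < y -> f x <= f y) -> nondecreasing_fun f.
  by move=> fP x y; rewrite le_eqVlt => /predU1P[->//|/fP].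
exists V; last first.
  move=> x; apply: ge_sup; last exact: LM.
  by exists 0; exact: variation_upto0.
split.
- by move=> x; apply: V_ge; exact: variation_upto0.
- apply: nd => x y /Vstep; apply: le_trans; by rewrite lerDl.
- apply: nd => x y /Vstep /=.
  by have := ler_norm (L x - L y); rewrite distrC; lra.
Qed.

Section negative_variation.
Context (R : realType) (L V : R -> R) (LV : compensator L V).
Local Notation N := (negative_variation L).

Lemma negative_variation_le (g : R -> R) (x : R) :
  compensator L g -> N x <= g x.
Proof.
move=> Lg; apply: ge_inf; last by exists g.
by exists 0 => _ [h [h0 _ _] <-].
Qed.

(** Here [V] matters: it makes the set of compensators nonempty, so that [inf] is a genuine infimum
    and not its default value. *)
Lemma le_negative_variation (x c : R) :
  (forall g, compensator L g -> c <= g x) -> c <= N x.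
Proof.
move=> cP; apply: lb_le_inf; first by exists (V x), V.
by move=> _ [g Lg <-]; exact: cP.
Qed.

(** The three conditions survive a pointwise infimum: for every compensator [g],
    [L x + N x <= L x + g x <= L y + g y], and then [g y] can be lowered to [N y]; the other two are
    similar. *)
Lemma compensator_negative_variation : compensator L N.
Proof.
split=> [x|x y xy|x y xy /=].
- by apply: le_negative_variation => g [].
- apply: le_negative_variation => g Lg.
  by rewrite (le_trans (negative_variation_le x Lg))//; case: Lg => _ /(_ _ _ xy).
- rewrite -lerBlDl; apply: le_negative_variation => g Lg.
  have := negative_variation_le x Lg.
  by case: Lg => _ _ /(_ _ _ xy) /=; lra.
Qed.

(* Were the limit positive, it could be subtracted from [N] to give a smaller
   compensator. *)
Lemma negative_variation_cvgNy : N x @[x --> -oo] --> 0.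
Proof.
have [N0 Nnd LNnd] := compensator_negative_variation.
apply/cvgrPdist_le => e e0.
have [x Nxe] : exists x, N x < e.
  apply: contrapT => /forallNP NP.
  have {}NP x : e <= N x by rewrite leNgt; exact/negP.
  have : compensator L (fun x => N x - e).
    split=> [x|x y /Nnd|x y /LNnd /=]; [by have := NP x; lra|lra|lra].
  by move/(negative_variation_le 0); lra.
near=> y; rewrite sub0r normrN ger0_norm// (le_trans _ (ltW Nxe))//.
by apply: Nnd; near: y; apply: nbhs_ninfty_le; rewrite num_real.
Unshelve. all: by end_near. Qed.

(* A jump of [N] at [x] from the right could be removed from [N] on [x, +oo[:
   lower semicontinuity says that it compensates no downward jump of [L]. *)
Lemma negative_variation_right_continuous :
  right_lower_semicontinuous L -> forall x, N y @[y --> x^'+] --> N x.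
Proof.
move=> Llsc x; have [N0 Nnd LNnd] := compensator_negative_variation.
have Lnear e : 0 < e -> \forall y \near x^'+, L x - e <= L y.
  move=> e0; have := Llsc x; rewrite limf_einfE => Lx.
  have : ((L x - e)%:E < ereal_sup
      [set ereal_inf ((EFin \o L) @` A) | A in nbhs (x^'+)])%E.
    by rewrite (lt_le_trans _ Lx)// lte_fin; lra.
  move=> /ereal_sup_gt[_ [A Ax <-]] LA.
  apply: filterS Ax => y Ay; rewrite -lee_fin (le_trans (ltW LA))//.
  by apply: ereal_inf_lbound; exists y.
apply/cvgrPdist_le => e e0.
(* As [N] is increasing, one such [z] controls all of []x, z]]. If there were none, [N] would jump
   by at least [e] just after [x]. *)
have [z xz Nz] : exists2 z, x < z & N z < N x + e.
  apply: contrapT => NP.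
  have {}NP z : x < z -> N x + e <= N z.
    by move=> xz; rewrite leNgt; apply/negP => Nz; apply: NP; exists z.
  (* The jump leaves a slack [e] in the growth of [L + N] past [x]: pass through some [y] in []x,
     z]] with [L y >= L x - d], where already [N y >= N x + e]. *)
  have LN z : x < z -> L x + N x <= L z + N z - e.
    move=> xz; apply/ler_addgt0Pr => d d0.
    have [y [xy yz Ly]] : exists y, [/\ x < y, y <= z & L x - d <= L y].
      near x^'+ => y; exists y; split; near: y; [exact: nbhs_right_gt|
        exact: nbhs_right_le|exact: Lnear].
    by have := LNnd _ _ yz; have := NP _ xy => /=; lra.
  have : compensator L (fun z => if z <= x then N z else N z - e).
    split=> [z|y z yz|y z yz /=].
    - by case: (leP z x) => [//|xz]; have := NP _ xz; have := N0 x; lra.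
    - case: (leP z x) => [zx|xz]; first by rewrite (le_trans yz zx) Nnd.
      case: (leP y x) => [yx|xy]; last by rewrite lerB ?Nnd.
      by have := Nnd _ _ yx; have := NP _ xz; lra.
    - have := LNnd _ _ yz => /=.
      case: (leP z x) => [zx|xz]; first by rewrite (le_trans yz zx).
      case: (leP y x) => [yx|xy]; last lra.
      by have := LNnd _ _ yx => /=; have := LN _ xz; lra.
  (* Any point to the right of [x] would do: there the new compensator lies below [N] by [e]. *)
  move/(negative_variation_le (x + 1)); rewrite ifF; first lra.
  by apply/negbTE; rewrite -ltNge; lra.
near=> y; have xy : x <= y by near: y; exact: nbhs_right_ge.
rewrite distrC ger0_norm ?subr_ge0 ?Nnd// lerBlDl (le_trans _ (ltW Nz))//.
by apply: Nnd; near: y; exact: nbhs_right_le.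
Unshelve. all: by end_near. Qed.

End negative_variation.

Lemma cdfun_of (R : realType) (g : R -> R) : nondecreasing_fun g ->
    (forall x, g y @[y --> x^'+] --> g x) ->
    g x @[x --> -oo] --> 0 -> g x @[x --> +oo] --> (1 : R) ->
  exists G : cdfun R, G =1 g.
Proof.
move=> gnd grc gNy gy.
pose c := isCumulative.Build R _ R g gnd grc.
pose b := isCumulativeBounded.Build R 0 1 g gNy gy.
pose G : cdfun R := HB.pack g c b.
by exists G.
Qed.

(** The CDF of the Dirac mass at 0 serves as an arbitrary [G] when the function to be normalized is
    zero. *)
Lemma cdfun_inhabited (R : realType) : exists G : cdfun R, True.
Proof.
have [| | | |G _] := @cdfun_of R (fun x => (0 <= x :> R)%R%:R); last by exists G.
- move=> x y xy; rewrite ler_nat.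
  by case: (leP 0 x) => // x0; rewrite (le_trans x0 xy).
- move=> x; apply: cvg_near_cst; case: (leP 0 x) => x0; near=> y.
    suff -> : 0 <= y by [].
    by rewrite (le_trans x0)//; near: y; exact: nbhs_right_ge.
  apply/eqP; rewrite pnatr_eq0 eqb0 -ltNge.
  by near: y; exact: nbhs_right_lt.
- apply: cvg_near_cst; near=> x; apply/eqP; rewrite pnatr_eq0 eqb0 -ltNge.
  by near: x; exact: nbhs_ninfty_lt.
- apply: cvg_near_cst; near=> x; suff -> : 0 <= x by [].
  by near: x; exact: nbhs_pinfty_ge.
Unshelve. all: by end_near. Qed.

Lemma cdfun_normalize (R : realType) (g : R -> R) : nondecreasing_fun g ->
    (forall x, 0 <= g x) -> has_ubound (range g) ->
    (forall x, g y @[y --> x^'+] --> g x) -> g x @[x --> -oo] --> 0 ->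
  exists (n : R) (G : cdfun R), forall x, g x <= n /\ n * G x = g x.
Proof.
move=> gnd g0 gub grc gNy; pose n := sup (range g).
have gn x : g x <= n by apply: ub_le_sup => //; exists x.
(* If [n = 0] then [g] vanishes and any CDF fits; otherwise [g / n] is a CDF, with limit 1 because a
   bounded increasing function tends to its supremum. *)
have := le_trans (g0 0) (gn 0); rewrite le_eqVlt => /predU1P[n0|n0].
  have [G _] := cdfun_inhabited R; exists 0, G => x.
  have gx : g x <= 0 by rewrite [leRHS]n0.
  by split=> //; apply/eqP; rewrite mul0r eq_le g0.
have [| | | |G GE] := @cdfun_of R (fun x => n^-1 * g x).
- by move=> x y xy; rewrite ler_pM2l ?invr_gt0// gnd.
- by move=> x; apply: cvgMr; exact: grc.
- by rewrite -[X in _ --> X](mulr0 n^-1); apply: cvgMr; exact: gNy.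
- rewrite -[X in _ --> X](mulVf (lt0r_neq0 n0)); apply: cvgMr.
  exact: nondecreasing_cvgr.
by exists n, G => x; split=> //; rewrite GE mulVKf// lt0r_neq0.
Qed.

Lemma nondecreasing_cvgNy (R : realType) (f : R -> R) :
  nondecreasing_fun f -> has_lbound (range f) ->
  f x @[x --> -oo] --> inf (range f).
Proof.
move=> fnd flb; have finf : has_inf (range f) by split=> //; exists (f 0), 0.
apply/cvgrPdist_le => e e0.
have [_ [z _ <-] fz] := inf_adherent e0 finf.
near=> x; rewrite distrC ger0_norm.
  rewrite lerBlDl (le_trans _ (ltW fz))//; apply: fnd; near: x.
  by apply: nbhs_ninfty_le; rewrite num_real.
by rewrite subr_ge0; apply: ge_inf => //; exists x.
Unshelve. all: by end_near. Qed.

(* A zero of [L + N] forces [L] to vanish on a left half-line, so in standard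
   representation everywhere, and then [0] itself is a compensator. *)
Lemma standard_representation_compensated (R : realType) (L : R -> R) (l : R) :
    0 < l -> (forall x, 0 <= L x) -> compensator L (negative_variation L) ->
  standard_representation L ->
  standard_representation (fun x => l * (L x + negative_variation L x)).
Proof.
set N := negative_variation L => l0 L0 [N0 Nnd LNnd] Lstd x.
move=> /ereal_inf_lt[_ [y /= Lincy <-] _]; move/eqP: Lincy.
rewrite mulf_eq0 gt_eqF//= => /eqP LNy.
have Ly z : z <= y -> L z = 0.
  by move=> /LNnd /=; have := L0 z; have := N0 z; rewrite LNy; lra.
have {Ly}L_eq0 z : L z = 0.
  (* A zero of [L] strictly to the left of [z], since [standard_representation] asks for a strict
     inequality. *)
  apply: Lstd; pose w := Num.min y (z - 1).
  apply: (@le_lt_trans _ _ w%:E).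
    by apply: ereal_inf_lbound; exists w => //; apply: Ly; rewrite ge_min lexx.
  by rewrite lte_fin gt_min [X in _ || X](_ : _ = true) ?orbT//; lra.
have : N x <= 0.
  apply: (@negative_variation_le _ _ (fun=> 0) x).
  by split=> // u v _; rewrite /= !L_eq0.
by have := N0 x; rewrite L_eq0 => Nx0 Nx; rewrite (_ : N x = 0) ?addr0 ?mulr0//; lra.
Qed.

Theorem theorem7p1 (R : realType) (L : R -> R)
    (L01 : unit_valued L)
    (LBV : bounded_variation_line L)
    (Lrlsc : right_lower_semicontinuous L) :
  exists (Linc : R -> R) (lambda : R) (G : cdfun R),
    [/\ unit_valued Linc /\ nondecreasing_fun Linc,
        0 < lambda <= 1 /\ limit_at_Ny Linc <= lambda,
        forall F : cdfun R,
          quantile_lower L F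
            = quantile_lower Linc (fun x => lambda * F x + (1 - lambda) * G x)
          /\ quantile_upper L F
            = quantile_upper Linc (fun x => lambda * F x + (1 - lambda) * G x)
      & standard_representation L -> standard_representation Linc].
Proof.
have Lbd : exists M, forall x, ubound (variation_upto L x) M.
  by have [M LM] := LBV; exists M => x v [a av]; apply: LM; exists a, x.
have [M LM] := Lbd; have [V LV VM] := compensator_variation LM.
pose N := negative_variation L.
have LN : compensator L N := compensator_negative_variation LV.
have [N0 Nnd LNnd] := LN.
have Nub : has_ubound (range N).
  exists M => _ [x _ <-]; exact: le_trans (negative_variation_le x LV) (VM x).
have [n [G nG]] := cdfun_normalize Nnd N0 Nub
  (negative_variation_right_continuous LV Lrlsc) (negative_variation_cvgNy LV).
have Nn x : N x <= n by have [] := nG x.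
have n0 : 0 <= n := le_trans (N0 0) (Nn 0).
have n1 : 0 < 1 + n by lra.
pose l := (1 + n)^-1; have l0 : 0 < l by rewrite invr_gt0.
have ln : l * (1 + n) = 1 by rewrite mulVf ?gt_eqF.
pose Linc x := l * (L x + N x).
have Linc01 : unit_valued Linc.
  move=> x; have /andP[L0 L1] := L01 x; rewrite mulr_ge0 ?addr_ge0 ?(ltW l0)//=.
  by rewrite -ln ler_pM2l// lerD.
have Lincnd : nondecreasing_fun Linc by move=> x y /LNnd; rewrite ler_pM2l.
(* The choice of [l] gives [1 - l = l * n], and [n * G] is [N]. *)
have mixE (F : cdfun R) x : l * F x + (1 - l) * G x = l * (F x + N x).
  have [_ <-] := nG x; rewrite mulrDr mulrA; congr (_ + _ * _).
  by rewrite -ln mulrDr mulr1 addrAC subrr add0r.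
exists Linc, l, G; split=> //.
- split; first by rewrite l0/= -ln ler_peMr ?(ltW l0)// lerDl.
  have Lcvg : Linc x @[x --> -oo] --> inf (range Linc).
    by apply: nondecreasing_cvgNy => //; exists 0 => _ [x _ <-]; case/andP: (Linc01 x).
  rewrite /limit_at_Ny (cvg_lim _ Lcvg)//.
  (* Since [L <= 1], this function dominates [Linc]; its limit is [l] because [N] vanishes at
     [-oo]. *)
  have lNcvg : l * (1 + N x) @[x --> -oo] --> l * (1 + 0).
    apply: cvgMr; apply: cvgD; first exact: cvg_cst.
    exact: negative_variation_cvgNy LV.
  rewrite -[leRHS]mulr1 -[X in l * X]addr0.
  apply: (ler_cvg_to Lcvg lNcvg); near=> x.
  by rewrite ler_pM2l// lerD2r; case/andP: (L01 x).
- move=> F; rewrite /quantile_lower /quantile_upper; split; congr (ereal_inf _).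
    congr image; apply/seteqP.
    by split=> x /=; rewrite mixE ler_pM2l// lerD2r.
  congr image; apply/seteqP.
  by split=> x /=; rewrite mixE ltr_pM2l// ltrD2r.
- by apply: standard_representation_compensated => // x; case/andP: (L01 x).
Unshelve. all: by end_near. Qed.
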